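(* Let $d\in\mathbb N$, $d\ge 1$. Suppose that the following pointwise estimate (Hypothesis A) holds for this $d$: for every $\varepsilon>0$ there is a constant $C_{d,\varepsilon}>0$ such that for every positive integer $N$, every prime number $q\in[N^{d/2},N^d]$, every integer $a$ with $1\le a\le q-1$, every real $t$ with $|t-a/q|\le 1/q^2$, and every real $x$, $$\bigg|\sum_{n=1}^N e^{2\pi i t n^d+2\pi i x n}\bigg|\le C_{d,\varepsilon}\,N^{\varepsilon}q^{1/d}.$$ Then for every real $p\ge d+1$ and every $\varepsilon>0$ there is a constant $C_{d,p,\varepsilon}>0$ such that for every positive integer $N$, $$S(N,p)\le C_{d,p,\varepsilon}\,N^{2p-d-1+\varepsilon}.$$
   Context: $\mathbb T=\mathbb R/\mathbb Z$, with Lebesgue measure normalized to total mass $1$. For a positive integer $N$ and real $p>0$ (with $d$ fixed), $$S(N,p):=\int_{\mathbb T^2}\bigg|\sum_{n=1}^N e^{2\pi i t n^d+2\pi i x n}\bigg|^{2p}\,dx\,dt.$$ *)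

(* Defs.v *)
From mathcomp Require Import all_boot all_order all_algebra.
From mathcomp Require Import all_classical all_reals all_analysis.
From mathcomp.real_closed Require Import complex.

Set Implicit Arguments.
Unset Strict Implicit.
Unset Printing Implicit Defensive.
Import Order.TTheory GRing.Theory Num.Theory.
Local Open Scope classical_set_scope.
Local Open Scope ring_scope.

(* e^{2 pi i u} *)
Definition expe (R : realType) (u : R) : R[i] :=
  Complex (cos (2 * pi * u)) (sin (2 * pi * u)).

Definition weyl_sum (R : realType) (d N : nat) (x t : R) : R[i] :=
  \sum_(1 <= n < N.+1) expe (t * n%:R ^+ d + x * n%:R).

(* [Normc.normc] is the complex modulus with values in [R]; the generic norm
   [`|z|] takes its values in [R[i]]. *)
Definition weyl_abs (R : realType) (d N : nat) (x t : R) : R :=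
  Normc.normc (weyl_sum d N x t).

(* The torus is represented by the fundamental domain [0, 1]^2, with
   coordinates (x, t).  The value is extended-real, so an upper bound on it
   also asserts finiteness. *)
Definition weyl_moment (R : realType) (d N : nat) (p : R) : \bar R :=
  (\int[lebesgue_measure \x lebesgue_measure]_(z in `[0%R, 1%R] `*` `[0%R, 1%R])
     (weyl_abs d N z.1 z.2 `^ (2 * p))%:E)%E.

Definition hypothesisA (R : realType) (d : nat) : Prop :=
  forall eps : R, 0 < eps ->
  exists2 C : R, 0 < C &
    forall N q a : nat, (0 < N)%N ->
    prime q -> N%:R `^ (d%:R / 2) <= q%:R :> R -> (q <= N ^ d)%N ->
    (1 <= a <= q - 1)%N ->
    forall t x : R, `|t - a%:R / q%:R| <= 1 / q%:R ^+ 2 ->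
    weyl_abs d N x t <= C * N%:R `^ eps * q%:R `^ (1 / d%:R).

(* Main.v *)
Require Import Defs.
From mathcomp Require Import all_boot all_order all_algebra.
From mathcomp Require Import all_classical all_reals all_analysis.
From mathcomp Require Import measurable_realfun.
From mathcomp.real_closed Require Import complex.
From mathcomp Require Import ring lra zify.
Import Order.TTheory GRing.Theory Num.Theory.
Import numFieldNormedType.Exports.

(* Put D = N^d.  By Abel summation, hypothesis A at t = a/q controls the Weyl sum
   on the whole neighbourhood |t - a/q| <= 1/D: there it is <<
   N^eps Q^(1/d) for every prime q <= Q with D <= q^2.  The functions counting
   the a with |t - a/q| <= 1/D, for distinct primes q, are nearly uncorrelated in t
   (Chinese remainder theorem), so by a second moment argument and Chebyshev's
   lower bound for the number of primes, the set E_Q of those t that are close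
   to no such a/q has measure << D (log Q)^2 / Q^2.  Since the integral of
   |S|^2 over x is N for every t (Parseval), decomposing t dyadically by
   E_Q \ E_2Q bounds the moment by the sum over Q <= D of
   N * (N^eps Q^(1/d))^(2p-2) * D / Q^2; for p >= d + 1 the exponent of Q is
   nonnegative, and Q = D dominates. *)

(** * Primes in dyadic ranges *)

(** By Legendre's formula the exponent of [p] in the binomial is the sum over [i >= 1] of [n %/ p ^
    i - m %/ p ^ i - (n - m) %/ p ^ i]. Each term is 0 or 1, and it vanishes once [p ^ i] exceeds
    [n]. *)
Lemma expn_logn_bin_le (n m p : nat) : (0 < n)%N -> (m <= n)%N -> prime p ->
  (p ^ logn p 'C(n, m) <= n)%N.
Proof.
move=> n_gt0 lemn pr_p; have p_gt1 := prime_gt1 pr_p.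
suff le_log : (logn p 'C(n, m) <= trunc_log p n)%N.
  exact: leq_trans (leq_pexp2l (prime_gt0 pr_p) le_log) (trunc_logP p_gt1 n_gt0).
(* Legendre's sums are padded with zero terms to a common range, so that the three factorials can be
   compared termwise. *)
have widen k : (k <= n)%N ->
    logn p k`! = (\sum_(1 <= i < n.+1) k %/ p ^ i)%N.
  move=> lekn; rewrite logn_fact // [RHS](@big_cat_nat _ _ _ k.+1) //=.
  rewrite [X in (_ + X)%N]big_nat [X in (_ + X)%N]big1 ?addn0 // => i /andP[ki _].
  by rewrite divn_small // (leq_trans ki) // ltnW // ltn_expl.
have eqL : (logn p 'C(n, m) + (logn p m`! + logn p (n - m)`!) = logn p n`!)%N.
  rewrite -(bin_fact lemn) !lognM ?muln_gt0 ?fact_gt0 ?bin_gt0 //.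
have leL : (logn p n`! <= trunc_log p n + (logn p m`! + logn p (n - m)`!))%N.
  rewrite !widen ?leq_subr // -big_split /=.
  have -> : trunc_log p n = (\sum_(1 <= i < n.+1) (p ^ i <= n))%N.
    have lt_tl : (trunc_log p n < n.+1)%N.
      by rewrite ltnS (leq_trans _ (trunc_logP p_gt1 n_gt0)) // ltnW // ltn_expl.
    rewrite (@big_cat_nat _ _ _ (trunc_log p n).+1) //=.
    rewrite [X in (X + _)%N]big_nat (eq_bigr (fun=> 1%N)); last first.
      move=> i /andP[_ il]; rewrite (leq_trans _ (trunc_logP p_gt1 n_gt0)) //.
      by rewrite leq_pexp2l ?prime_gt0.
    rewrite -big_nat sum_nat_const_nat muln1 subn1 /= big_nat big1 ?addn0 //.
    move=> i /andP[il _]; apply/eqP; rewrite eqb0 -ltnNge.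
    exact: leq_trans (trunc_log_ltn n p_gt1) (leq_pexp2l (prime_gt0 pr_p) il).
  rewrite -big_split /=; apply: leq_sum => i _.
  have [le_pn|gt_pn] := leqP (p ^ i) n; last by rewrite divn_small.
  have pi_gt0 : (0 < p ^ i)%N by rewrite expn_gt0 prime_gt0.
  rewrite -{1}(subnKC lemn) divnD // addnC leq_add2r.
  exact: leq_b1.
lia.
Qed.

Lemma expn2_le_bin (n : nat) : (2 ^ n <= 'C(n.*2, n))%N.
Proof.
elim: n => [|n IHn] //; rewrite doubleS binS expnS mul2n -addnn.
apply: leq_add; apply: leq_trans IHn _.
  by rewrite binS leq_addl.
by rewrite leq_bin2l.
Qed.

Definition primes_upto (n : nat) : seq nat := [seq p <- iota 0 n.+1 | prime p].

Lemma mem_primes_upto (n p : nat) : (p \in primes_upto n) = prime p && (p <= n)%N.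
Proof. by rewrite mem_filter mem_iota. Qed.

Lemma primes_upto_uniq (n : nat) : uniq (primes_upto n).
Proof. by rewrite filter_uniq ?iota_uniq. Qed.

(** The central binomial coefficient is at least [2 ^ n], and it is a product of prime powers, one
    for each of its prime divisors. These primes and their powers are all at most [n.*2]. *)
Lemma expn2_le_primes_upto (n : nat) : (0 < n)%N ->
  (2 ^ n <= n.*2 ^ size (primes_upto n.*2))%N.
Proof.
move=> n_gt0; apply: leq_trans (expn2_le_bin n) _.
set b := 'C(n.*2, n); have le_n : (n <= n.*2)%N by rewrite -addnn leq_addr.
have b_gt0 : (0 < b)%N by rewrite bin_gt0.
have n2_gt0 : (0 < n.*2)%N by rewrite double_gt0.
rewrite (prod_prime_decomp b_gt0) prime_decompE big_map /=.
have sub : {subset primes b <= primes_upto n.*2}.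
  move=> p; rewrite mem_primes mem_primes_upto => /and3P[pr_p _ dvd_pb].
  rewrite pr_p /=; have le_b := expn_logn_bin_le _ _ _ n2_gt0 le_n pr_p.
  apply: leq_trans le_b; rewrite -{1}(expn1 p).
  apply: leq_pexp2l; rewrite ?(prime_gt0 pr_p) //.
  by rewrite logn_gt0 mem_primes pr_p b_gt0.
apply: (@leq_trans (n.*2 ^ size (primes b))%N); last first.
  by rewrite leq_pexp2l ?double_gt0 // uniq_leq_size ?primes_uniq.
rewrite -sum1_size expn_sum 2!big_seq; apply: leq_prod => p.
rewrite expn1 mem_primes => /andP[pr_p _].
exact: expn_logn_bin_le.
Qed.

(* Chebyshev's lower bound [pi(x) >> x / log x] along powers of two. *)
Lemma primes_upto_expn2 (k : nat) :
  (2 ^ k <= k.+1 * size (primes_upto (2 ^ k.+1)))%N.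
Proof.
have := expn2_le_primes_upto (2 ^ k); rewrite expn_gt0 -mul2n -expnS -expnM.
by move=> /(_ isT); rewrite leq_exp2l.
Qed.

(** * Exceptional cells *)

Lemma sum_ord_ltn (m v : nat) : (v <= m)%N -> (\sum_(r < m) (r < v) = v)%N.
Proof.
move=> le_vm.
rewrite -(big_mkord xpredT (fun r => (r < v : nat)%N)) (@big_cat_nat _ _ _ v) //=.
rewrite big_nat (eq_bigr (fun=> 1%N)); last by move=> i /andP[_ ->].
rewrite -big_nat sum_nat_const_nat muln1 subn0 big_nat big1 ?addn0 //.
by move=> i /andP[vi _]; rewrite ltnNge vi.
Qed.

Lemma sum_modn_lt (q m v : nat) : (v <= m)%N ->
  (\sum_(j < q * m) (j %% m < v) = q * v)%N.
Proof.
move=> le_vm; elim: q => [|q IHq]; first by rewrite mul0n big_ord0.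
rewrite mulSnr big_split_ord /= IHq mulSnr; congr (_ + _)%N.
rewrite (eq_bigr (fun r : 'I_m => (r < v : nat)%N)); last first.
  by move=> r _; rewrite modnMDl modn_small.
exact: sum_ord_ltn.
Qed.

(* By the Chinese remainder theorem [j] is recovered from its residues [u], [w]
   modulo [q' m] and [q m]; since [u = w %[mod m]], the pair [(u, w)] is in turn
   recovered from [(u, w %/ m)]. *)
Lemma sum_modn_lt2 (q q' m v : nat) : coprime q q' -> (0 < m)%N ->
  (\sum_(j < q * q' * m) ((j %% (q' * m) < v) && (j %% (q * m) < v))
     <= v * (v %/ m).+1)%N.
Proof.
move=> co_qq' m_gt0.
pose A := [set j : 'I_(q * q' * m) | (j %% (q' * m) < v) && (j %% (q * m) < v)].
rewrite -big_mkcond sum1dep_card -/A.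
case: v @A => [|v] A.
  rewrite mul0n leqn0 cards_eq0; apply/eqP/setP => j. by rewrite !inE ltn0.
pose f (j : 'I_(q * q' * m)) : 'I_v.+1 * 'I_(v.+1 %/ m).+1 :=
  (inord (j %% (q' * m)), inord (j %% (q * m) %/ m)).
have -> : (v.+1 * (v.+1 %/ m).+1 = #|{: 'I_v.+1 * 'I_(v.+1 %/ m).+1}|)%N.
  by rewrite card_prod !card_ord.
have inj_f : {in A &, injective f}.
  move=> i j; rewrite !inE => /andP[i1 i2] /andP[j1 j2] [].
  move=> /(congr1 val) /=; rewrite !inordK // => e1.
  have dvm z : (z < v.+1 -> z %/ m < (v.+1 %/ m).+1)%N.
    by move=> zv; rewrite ltnS leq_div2r // ltnW.
  move=> /(congr1 val) /=; rewrite !inordK ?dvm // => e2.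
  have e3 : (i %% (q * m) = j %% (q * m))%N.
    rewrite (divn_eq (i %% (q * m)) m) (divn_eq (j %% (q * m)) m) e2.
    rewrite !modn_dvdm ?dvdn_mull //.
    by rewrite -(@modn_dvdm (q' * m) i) ?dvdn_mull // e1 modn_dvdm ?dvdn_mull.
  have main (x y : nat) : (x <= y < q * q' * m)%N ->
      x = y %[mod q' * m] -> x = y %[mod q * m] -> x = y.
    move=> /andP[xy ylt] /eqP h1 /eqP h2.
    move: h1 h2; rewrite ![(x == _ %[mod _])%N]eq_sym !eqn_mod_dvd // => h1 h2.
    have : (q * q' * m %| y - x)%N.
      have dm : (m %| y - x)%N by apply: dvdn_trans h1; rewrite dvdn_mull.
      rewrite -(divnK dm) dvdn_pmul2r // Gauss_dvd //.
      apply/andP; split; rewrite -(dvdn_pmul2r m_gt0) (divnK dm) //.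
    have [->//|ne] := eqVneq x y.
    move=> /dvdn_leq le_zyx; have : (0 < y - x)%N by rewrite subn_gt0 ltn_neqAle ne.
    by move=> /le_zyx; rewrite leqNgt (leq_ltn_trans (leq_subr _ _) ylt).
  apply: val_inj => /=; have [le_ij|lt_ji] := leqP i j.
    by apply: main => //; rewrite le_ij /=.
  by apply/esym; apply: main => //; rewrite (ltnW lt_ji) /=.
by rewrite -(card_in_imset inj_f) max_card.
Qed.

(* Second moment: the number [F j] of [q] in [P] with [j %% (M %/ q) < V] has mean
   [V S / M], where [S] is the sum of [P], and the [q] are nearly independent. *)
Lemma count_coprime_avoid (P : seq nat) (M V : nat) : (0 < V)%N ->
  uniq P -> all prime P ->
  {in P, forall q, (q * V <= M)%N} ->
  {in P, forall q, (q %| M)%N} ->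
  {in P &, forall q q', q != q' -> (q * q' %| M)%N} ->
  ((\sum_(j < M) all (fun q => V <= j %% (M %/ q)) P) * V * (\sum_(q <- P) q) ^ 2
     <= M ^ 2 * (\sum_(q <- P) q + size P ^ 2))%N.
Proof.
move=> V_gt0 uP prP leVM dvM dvM2.
set S := (\sum_(q <- P) q)%N; set n := size P.
pose f (q j : nat) : nat := (j %% (M %/ q) < V)%N.
pose F (j : nat) : nat := (\sum_(q <- P) f q j)%N.
pose b (j : nat) : nat := all (fun q => V <= j %% (M %/ q))%N P.
rewrite -/(b _).
have [->|M_gt0] := posnP M; first by rewrite big_ord0.
have sumf q : q \in P -> (\sum_(j < M) f q j = q * V)%N.
  move=> qP; have prq := prime_gt0 (allP prP q qP).
  have := sum_modn_lt q (M %/ q) V; rewrite mulnC (divnK (dvM q qP)) => -> //.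
  by rewrite leq_divRL // mulnC leVM.
have sumF : (\sum_(j < M) F j = V * S)%N.
  rewrite /F exchange_big /= big_seq (eq_bigr (fun q => q * V)%N) //.
  by rewrite -big_seq -big_distrl mulnC.
(* The first term on the right is what exact independence would give; [M * V] pays for the rounding
   in [(V %/ m).+1]. *)
have sumf2 q q' : q \in P -> q' \in P -> q != q' ->
    (M * \sum_(j < M) f q j * f q' j <= V ^ 2 * (q * q') + M * V)%N.
  move=> qP q'P ne; have prq := allP prP q qP; have prq' := allP prP q' q'P.
  have q0 := prime_gt0 prq; have q'0 := prime_gt0 prq'.
  have co : coprime q q'.
    by rewrite prime_coprime // dvdn_prime2.
  have dv := dvM2 q q' qP q'P ne.
  have [m eM] : exists m, (M = q * q' * m)%N.
    by exists (M %/ (q * q'))%N; rewrite mulnC divnK.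
  have m_gt0 : (0 < m)%N by move: M_gt0; rewrite eM muln_gt0 => /andP[].
  have e1 : (M %/ q = q' * m)%N by rewrite eM -mulnA mulKn.
  have e2 : (M %/ q' = q * m)%N by rewrite eM (mulnC q) -mulnA mulKn.
  have le2 : (\sum_(j < M) f q j * f q' j <= V * (V %/ m).+1)%N.
    have := sum_modn_lt2 q q' m V co m_gt0; rewrite -eM; apply: leq_trans.
    by apply: leq_sum => j _; rewrite /f e1 e2 mulnb.
  have := leq_trunc_div V m => le3.
  have : (M * (V * (V %/ m).+1) <= V ^ 2 * (q * q') + M * V)%N.
    rewrite mulnS addnC mulnDr leq_add2r // eM.
    have -> : (q * q' * m * (V * (V %/ m)) = (V * (q * q')) * (V %/ m * m))%N by lia.
    by apply: leq_trans (leq_mul (leqnn _) le3) _; rewrite expnS expn1; lia.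
  by apply: leq_trans; rewrite leq_mul2l le2 orbT.
have sumF2 : (M * \sum_(j < M) F j ^ 2
     <= M * (V * S) + V ^ 2 * S ^ 2 + M * V * n ^ 2)%N.
  have -> : (\sum_(j < M) F j ^ 2 =
      \sum_(q <- P) \sum_(q' <- P) \sum_(j < M) f q j * f q' j)%N.
    rewrite (eq_bigr (fun j : 'I_M => \sum_(q <- P) \sum_(q' <- P) f q j * f q' j)%N).
      rewrite exchange_big; apply: eq_bigr => q _; exact: exchange_big.
    by move=> j _; rewrite expnS expn1 /F big_distrlr.
  have -> : (M * (V * S) + V ^ 2 * S ^ 2 + M * V * n ^ 2 =
      \sum_(q <- P) \sum_(q' <- P)
        ((q == q') * (M * (q * V)) + (V ^ 2 * (q * q') + M * V)))%N.
    under eq_bigr => q _ do rewrite big_split /= big_split /=.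
    rewrite big_split /= big_split /= -addnA; congr (_ + (_ + _))%N.
    - rewrite /S mulnCA !big_distrr /= [LHS]big_seq [RHS]big_seq.
      apply: eq_bigr => q qP; rewrite (big_rem q qP) /= eqxx mul1n.
      rewrite big_seq big1 ?addn0; first by rewrite mulnCA (mulnC V).
      move=> q'; rewrite mem_rem_uniq // inE => /andP[/negPf ne _].
      by rewrite eq_sym ne.
    - rewrite [(S ^ 2)%N]expnS expn1 /S big_distrlr /= !big_distrr /=.
      by apply: eq_bigr => q _; rewrite big_distrr.
    - rewrite !(big_const_seq, count_predT) !iter_addn_0 -/n; lia.
  rewrite big_distrr [X in (X <= _)%N]big_seq [X in (_ <= X)%N]big_seq.
  apply: leq_sum => q qP.
  rewrite big_distrr [X in (X <= _)%N]big_seq [X in (_ <= X)%N]big_seq.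
  apply: leq_sum => q' q'P.
  have [<-|ne] := eqVneq q q'; last by rewrite mul0n add0n sumf2.
  rewrite mul1n (eq_bigr (fun j : 'I_M => f q j)) ?sumf ?leq_addr //.
  by move=> j _; rewrite /f; case: (_ < _)%N.
(* Chebyshev's inequality [b j * (V * S) ^ 2 <= (M * F j - V * S) ^ 2], expanded so that no
   truncated subtraction occurs: [F j = 0] wherever [b j = 1]. *)
have pt j : (b j * (V * S) ^ 2 + 2 * (M * (V * S)) * F j
    <= M ^ 2 * F j ^ 2 + (V * S) ^ 2)%N.
  rewrite /b; case: allP => [av|_] /=.
    have -> : F j = 0%N.
      rewrite /F big_seq big1 // => q qP; rewrite /f.
      by have := av q qP; rewrite ltnNge => ->.
    by rewrite muln0 addn0 mul1n leq_addl.
  rewrite mul0n add0n -expnMn.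
  have [+ _] := nat_Cauchy (M * F j) (V * S); congr (_ <= _)%N.
  by rewrite -[in RHS]mulnA (mulnAC M) !mulnA.
have tot : ((\sum_(j < M) b j) * (V * S) ^ 2 + 2 * (M * (V * S)) * (V * S)
    <= M ^ 2 * \sum_(j < M) F j ^ 2 + M * (V * S) ^ 2)%N.
  have -> : (M * (V * S) ^ 2 = \sum_(j < M) (V * S) ^ 2)%N.
    by rewrite sum_nat_const card_ord.
  rewrite -{3}sumF; move: (V * S)%N pt => Z pt.
  rewrite big_distrl 2!big_distrr. rewrite -!big_split /=.
  by apply: leq_sum => j _; exact: pt.
have {}sumF2 := leq_mul (leqnn M) sumF2.
rewrite -(leq_pmul2r V_gt0); move: tot sumF2; rewrite /b.
move: (\sum_(j < M) _)%N (\sum_(j < M) _)%N => X Y; lia.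
Qed.

Lemma leq_size_uniq_pos (s : seq nat) (n : nat) : uniq s ->
  {in s, forall x, (0 < x <= n)%N} -> (size s <= n)%N.
Proof.
move=> us sn; rewrite -(size_iota 1 n) uniq_leq_size // => x /sn.
by rewrite mem_iota add1n ltnS.
Qed.

(** Of any two entries one is at most the other, and at most [x] entries are bounded by the entry
    [x], since they are distinct and positive. Counting ordered pairs gives the claim. *)
Lemma size_sq_le_sum (s : seq nat) : uniq s -> {in s, forall x, (0 < x)%N} ->
  (size s ^ 2 <= 2 * \sum_(x <- s) x)%N.
Proof.
move=> us s_gt0.
have le1 : (\sum_(x <- s) \sum_(y <- s) (y <= x) <= \sum_(x <- s) x)%N.
  rewrite [X in (X <= _)%N]big_seq [X in (_ <= X)%N]big_seq.
  apply: leq_sum => x xs.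
  rewrite -big_mkcond sum1_count -size_filter leq_size_uniq_pos ?filter_uniq //.
  by move=> y; rewrite mem_filter => /andP[-> /s_gt0 ->].
rewrite mul2n -addnn; apply: leq_trans (leq_add le1 le1).
rewrite [X in (_ <= _ + X)%N]exchange_big /= -big_split /=.
have -> : (size s ^ 2 = \sum_(x <- s) \sum_(y <- s) 1)%N.
  by rewrite sum1_size big_const_seq count_predT iter_addn_0 expnS expn1.
apply: leq_sum => x _; rewrite -big_split /=; apply: leq_sum => y _.
by case: (leqP y x) => // /ltnW ->.
Qed.

(** With [D = N ^ d], the condition [D <= q ^ 2] is the lower bound on [q] in hypothesis A,
    squared. *)
Definition good_primes (D k : nat) : seq nat :=
  [seq q <- primes_upto (2 ^ k) | D <= q ^ 2].

(* With [M = D * D`!], the condition [j %% (M %/ q) < D`!] says that [j / M] lies in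
   [[a / q, a / q + 1 / D)] for [a = j %/ (M %/ q)]; since [D`! <= M %/ q], the
   fractions with [a = 0] account exactly for [j < D`!]. *)
Definition exceptional (D k j : nat) : bool :=
  (j < D`!) || all (fun q => D`! <= j %% (D * D`! %/ q)) (good_primes D k).

Lemma mem_good_primes (D k q : nat) :
  (q \in good_primes D k) = [&& prime q, q <= 2 ^ k & D <= q ^ 2].
Proof. by rewrite mem_filter mem_primes_upto andbC andbA. Qed.

Lemma good_primes_uniq (D k : nat) : uniq (good_primes D k).
Proof. by rewrite filter_uniq ?primes_upto_uniq. Qed.

(* The maximum covers the case where [2 ^ k] is too close to [sqrt D] for enough
   primes above [sqrt D] to exist; the count of exceptional cells is then trivial. *)
Lemma size_good_primes (D k : nat) :
  (4 ^ k.+1 <= 16 * k.+1 ^ 2 * maxn D (size (good_primes D k.+1) ^ 2))%N.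
Proof.
set s := good_primes D k.+1.
pose r := [seq q <- primes_upto (2 ^ k.+1) | ~~ (D <= q ^ 2)].
have eqsz : (size s + size r = size (primes_upto (2 ^ k.+1)))%N.
  by rewrite -(count_predC (fun q => D <= q ^ 2)%N (primes_upto _)) -!size_filter.
(* Some element of [r] is at least [size r], the elements being distinct and positive, while the
   square of every element is below [D]. *)
have ler : (size r ^ 2 <= D)%N.
  have [->//|r0] := posnP (size r).
  have [x]: exists2 x, x \in r & (size r <= x)%N.
    apply/hasP; apply: contraT => /hasPn nhas.
    have := @leq_size_uniq_pos r (size r).-1.
    rewrite filter_uniq ?primes_upto_uniq // => /(_ isT) h.
    suff : (size r <= (size r).-1)%N by lia.
    apply: h => x xr; have := nhas x xr; move: (xr).
    by rewrite mem_filter mem_primes_upto => /and3P[_ /prime_gt0]; lia.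
  rewrite mem_filter -ltnNge => /andP[/ltnW lt _] le; apply: leq_trans lt.
  by rewrite leq_sqr.
have := primes_upto_expn2 k; rewrite -eqsz mulnDr => cheb.
have e4 : (4 ^ k.+1 = 4 * (2 ^ k) ^ 2)%N by rewrite expnS -expnM (mulnC k) expnM.
(* The larger of the two parts holds at least half of the primes; squaring that half gives the
   constant [16 = 4 * 2 ^ 2]. *)
rewrite e4; have [le_rs|lt_sr] := leqP (size r) (size s).
  apply: (@leq_trans (4 * (k.+1 * (2 * size s)) ^ 2)%N).
    by rewrite leq_mul2l leq_sqr /=; have := leq_mul (leqnn k.+1) le_rs; lia.
  have := leq_maxr D (size s ^ 2); rewrite !expnMn; nia.
apply: (@leq_trans (4 * (k.+1 * (2 * size r)) ^ 2)%N).
  by rewrite leq_mul2l leq_sqr /=; have := leq_mul (leqnn k.+1) (ltnW lt_sr); lia.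
have := leq_maxl D (size s ^ 2); rewrite !expnMn; nia.
Qed.

Lemma count_exceptional (D k : nat) : (0 < D)%N -> (2 ^ k <= D)%N ->
  (4 ^ k * (\sum_(j < D * D`!) exceptional D k j)
     <= 97 * (k.+1) ^ 2 * D * (D * D`!))%N.
Proof.
move=> D_gt0 le_kD; set V := D`!; set M := (D * V)%N.
have V_gt0 : (0 < V)%N by exact: fact_gt0.
set cnt := (\sum_(j < M) _)%N.
have cntM : (cnt <= M)%N.
  rewrite -[X in (_ <= X)%N]card_ord -sum1_card; apply: leq_sum => j _.
  exact: leq_b1.
case: k le_kD @cnt cntM => [|k] le_kD cnt cntM; first by nia.
have := size_good_primes D k; set P := good_primes D k.+1.
have [le_P|lt_P] := leqP (size P ^ 2) D.
  move=> h; apply: leq_trans (leq_mul h cntM) _; nia.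
move=> h.
have inP q : q \in P -> [/\ prime q, (q <= D)%N & (D <= q ^ 2)%N].
  rewrite mem_good_primes => /and3P[pr_q le_q ->].
  by split=> //; apply: leq_trans le_q le_kD.
have dvV q : q \in P -> (q %| V)%N.
  by move=> /inP[pr_q le_qD _]; apply: dvdn_fact; rewrite prime_gt0.
set b := (\sum_(j < M) all (fun q => V <= j %% (M %/ q)) P)%N.
have leb : (b * V * (\sum_(q <- P) q) ^ 2
     <= M ^ 2 * (\sum_(q <- P) q + size P ^ 2))%N.
  apply: count_coprime_avoid => //.
  - exact: good_primes_uniq.
  - by apply/allP => q /inP[].
  - by move=> q /inP[_ le_qD _]; rewrite leq_mul2r le_qD orbT.
  - by move=> q /dvV dv; rewrite dvdn_mull.
  move=> q q' qP q'P ne; apply: dvdn_mull; rewrite Gauss_dvd ?dvV //.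
  have [pr_q _ _] := inP q qP; have [pr_q' _ _] := inP q' q'P.
  by rewrite prime_coprime // dvdn_prime2.
have cntb : (cnt <= V + b)%N.
  have -> : (V = \sum_(j < M) (j < V))%N.
    by rewrite sum_ord_ltn ?leq_pmull.
  rewrite -big_split; apply: leq_sum => j _ /=.
  by rewrite /exceptional -/V -/M -/P; case: (_ < _)%N; case: (all _ _).
have leS : (size P ^ 2 <= 2 * \sum_(q <- P) q)%N.
  by apply: size_sq_le_sum (good_primes_uniq _ _) _ => q /inP[/prime_gt0].
move: leb leS h lt_P; move: (\sum_(q <- P) q)%N (size P) => S n leb leS h lt_P.
have S_gt0 : (0 < S)%N by lia.
have b2 : (b * n ^ 2 <= 6 * D * M)%N.
  have : (b * V * S ^ 2 <= M ^ 2 * (3 * S))%N.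
    by apply: leq_trans leb _; rewrite leq_mul2l; apply/orP; right; lia.
  have -> : (M ^ 2 * (3 * S) = (3 * D * M) * (V * S))%N by rewrite /M; nia.
  have -> : (b * V * S ^ 2 = (b * S) * (V * S))%N by nia.
  rewrite leq_pmul2r ?muln_gt0 ?V_gt0 // => bS.
  by apply: leq_trans (leq_mul (leqnn b) leS) _; nia.
have k4 : (4 ^ k.+1 <= D ^ 2)%N.
  by rewrite -[4%N]/(2 ^ 2)%N -expnM mulnC expnM leq_sqr.
apply: leq_trans (leq_mul (leqnn _) cntb) _; rewrite mulnDr.
have t1 : (4 ^ k.+1 * V <= D * M)%N.
  by apply: leq_trans (leq_mul k4 (leqnn V)) _; rewrite /M; nia.
have t2 : (4 ^ k.+1 * b <= 96 * k.+1 ^ 2 * D * M)%N.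
  by apply: leq_trans (leq_mul h (leqnn b)) _; nia.
nia.
Qed.

Local Open Scope classical_set_scope.
Local Open Scope ring_scope.

(* [mathcomp-analysis] has an unrelated [expe], on [\bar R]. *)
Local Notation expe := Defs.expe.

(** * Pointwise bounds *)

Lemma ler_normcD (R : rcfType) (x y : R[i]) :
  Normc.normc (x + y) <= Normc.normc x + Normc.normc y.
Proof. exact: (@le_normcD R x y). Qed.

Lemma normc_ge0 (R : rcfType) (x : R[i]) : 0 <= Normc.normc x.
Proof. by case: x => a b; exact: sqrtr_ge0. Qed.

Lemma ler_normc_sum (R : rcfType) (I : Type) (r : seq I) (F : I -> R[i]) :
  Normc.normc (\sum_(i <- r) F i) <= \sum_(i <- r) Normc.normc (F i).
Proof.
elim/big_ind2: _ => [|x1 y1 x2 y2 h1 h2|//]; first by rewrite Normc.normc0.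
exact: le_trans (ler_normcD _ _ _) (lerD h1 h2).
Qed.

Lemma normc_le_abs (R : rcfType) (a b : R) :
  Normc.normc (Complex a b) <= `|a| + `|b|.
Proof.
have -> : `|a| + `|b| = Num.sqrt ((`|a| + `|b|) ^+ 2).
  by rewrite sqrtr_sqr [RHS]ger0_norm ?addr_ge0.
apply: ler_wsqrtr.
by rewrite sqrrD !real_normK ?num_real // addrAC lerDl mulrn_wge0 ?mulr_ge0 //.
Qed.

Lemma dist_cos_le (R : realType) (x y : R) : `|cos x - cos y| <= `|x - y|.
Proof.
wlog le_yx : x y / y <= x => [hw|].
  have [/hw//|/ltW/hw] := leP y x.
  by rewrite distrC (distrC y).
have [c _ ->] := @MVT_segment R cos (fun z => - sin z) y x le_yx
  (fun z _ => is_derive_cos z) (continuous_subspaceT (@continuous_cos R)).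
by rewrite normrM normrN ler_piMl ?sin_max.
Qed.

Lemma dist_sin_le (R : realType) (x y : R) : `|sin x - sin y| <= `|x - y|.
Proof.
have := dist_cos_le _ (x - pi / 2) (y - pi / 2).
by rewrite !cosBpihalf opprB addrA subrK.
Qed.

Lemma expeD (R : realType) (u v : R) : expe (u + v) = expe u * expe v.
Proof.
apply/eqP; rewrite eq_complex /= mulrDr cosD sinD eqxx /=.
by rewrite [X in _ == X]addrC; apply/eqP; ring.
Qed.

Lemma normc_expe (R : realType) (u : R) : Normc.normc (expe u) = 1.
Proof. by rewrite /= cos2Dsin2 sqrtr1. Qed.

Lemma normc_expeB (R : realType) (u v : R) :
  Normc.normc (expe u - expe v) <= 4 * pi * `|u - v|.
Proof.
apply: le_trans (normc_le_abs _ _ _) _.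
have -> : 4 * pi * `|u - v| = `|2 * pi * u - 2 * pi * v| *+ 2.
  rewrite -mulrBr normrM ger0_norm ?mulr_ge0 ?pi_ge0 //; ring.
by rewrite mulr2n lerD ?dist_cos_le ?dist_sin_le.
Qed.

Lemma sum_mul_by_parts (A : comNzRingType) (z w : nat -> A) (N : nat) :
  \sum_(0 <= n < N) z n.+1 * w n.+1 = (\sum_(0 <= n < N) z n.+1) * w N
    + \sum_(0 <= n < N) (\sum_(0 <= m < n) z m.+1) * (w n - w n.+1).
Proof.
elim: N => [|N IHN]; first by rewrite !big_nil mul0r addr0.
rewrite !big_nat_recr //= IHN; ring.
Qed.

(* Abel summation: replacing [t0] by [t] multiplies the summands by
   [expe ((t - t0) n^d)], a sequence of total variation at most
   [4 pi |t - t0| N^d]. *)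
Lemma weyl_abs_perturb (R : realType) (d N : nat) (x t t0 B : R) :
  `|t - t0| * N%:R ^+ d <= 1 ->
  (forall m : nat, (m <= N)%N -> weyl_abs d m x t0 <= B) ->
  weyl_abs d N x t <= (1 + 4 * pi) * B.
Proof.
move=> ht hB; set u := t - t0.
pose z n := expe (t0 * n%:R ^+ d + x * n%:R).
pose w n := expe (u * n%:R ^+ d).
have wsE m s : weyl_sum d m x s =
    \sum_(0 <= n < m) expe (s * n.+1%:R ^+ d + x * n.+1%:R).
  by rewrite /weyl_sum big_add1.
have eS : weyl_sum d N x t = \sum_(0 <= n < N) z n.+1 * w n.+1.
  rewrite wsE; apply: eq_bigr => n _; rewrite /z /w -expeD /u; congr expe; ring.
have hS m : (m <= N)%N -> Normc.normc (\sum_(0 <= n < m) z n.+1) <= B.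
  by move=> /hB; rewrite /weyl_abs wsE.
rewrite /weyl_abs eS sum_mul_by_parts.
apply: le_trans (ler_normcD _ _ _) _; rewrite mulrDl mul1r.
apply: lerD; first by rewrite Normc.normcM normc_expe mulr1 hS.
apply: le_trans (ler_normc_sum _ _ _ _) _.
apply: (@le_trans _ _ (\sum_(0 <= n < N)
    B * (4 * pi * (`|u| * (n.+1%:R ^+ d - n%:R ^+ d))))).
  rewrite !big_nat; apply: ler_sum => n /andP[_ nN].
  rewrite Normc.normcM; apply: ler_pM; rewrite ?normc_ge0 ?hS 1?ltnW //.
  apply: le_trans (normc_expeB _ _ _) _.
  rewrite -mulrBr normrM (distrC (n%:R ^+ d)) [`|_ - n%:R ^+ d|]ger0_norm //.
  by rewrite subr_ge0 lerXn2r ?nnegrE ?ler_nat.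
rewrite -!mulr_sumr telescope_sumr // mulrC ler_wpM2r //.
  exact: le_trans (normc_ge0 _ _) (hS 0%N _).
rewrite ler_piMr ?mulr_ge0 ?pi_ge0 //; apply: le_trans ht.
by rewrite ler_wpM2l // gerBl exprn_ge0.
Qed.

Lemma weyl_abs_le_nat (R : realType) (d N : nat) (x t : R) :
  weyl_abs d N x t <= N%:R.
Proof.
apply: le_trans (ler_normc_sum _ _ _ _) _.
rewrite (eq_bigr (fun=> 1)) => [|n _]; last exact: normc_expe.
by rewrite sumr_const_nat subn1.
Qed.

Lemma natr_powRX (R : realType) (m d : nat) : (0 < d)%N ->
  m%:R = (m ^ d)%:R `^ (1 / d%:R) :> R.
Proof.
move=> d_gt0; rewrite natrX -powR_mulrn // -powRrM mulrA mulr1 divff ?powRr1 //.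
by rewrite pnatr_eq0 -lt0n.
Qed.

(* For [m ^ d < q] hypothesis A does not apply to the sum of length [m], but
   then the trivial bound [m <= q ^ (1 / d)] suffices. *)
Lemma weyl_abs_major (R : realType) (d : nat) (eps C : R) (N q a : nat) (x t : R) :
  (1 <= d)%N -> 0 < eps -> 0 < C ->
  (forall N q a : nat, (0 < N)%N ->
    prime q -> N%:R `^ (d%:R / 2) <= q%:R :> R -> (q <= N ^ d)%N ->
    (1 <= a <= q - 1)%N ->
    forall t x : R, `|t - a%:R / q%:R| <= 1 / q%:R ^+ 2 ->
    weyl_abs d N x t <= C * N%:R `^ eps * q%:R `^ (1 / d%:R)) ->
  (0 < N)%N -> prime q -> (N ^ d <= q ^ 2)%N -> (1 <= a < q)%N ->
  `|t - a%:R / q%:R| <= 1 / (N ^ d)%:R ->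
  weyl_abs d N x t <= (1 + 4 * pi) * ((C + 1) * N%:R `^ eps * q%:R `^ (1 / d%:R)).
Proof.
move=> d_gt0 eps_gt0 C_gt0 hA N_gt0 pr_q leNq aq ht.
have q_gt0 := prime_gt0 pr_q.
(* Hypothesis A is invoked only at the centre [a / q], because its radius [1 / q ^ 2] may be smaller
   than [1 / N ^ d]. Abel summation covers the larger radius, but needs the bound for all shorter
   sums. *)
apply: (@weyl_abs_perturb _ _ _ _ _ (a%:R / q%:R)).
  by rewrite -natrX -ler_pdivlMr // ltr0n expn_gt0 N_gt0.
move=> m le_mN.
have N1 : 1 <= N%:R `^ eps :> R.
  by rewrite -[leLHS](powRr0 N%:R); apply: ler_powR; rewrite ?ler1n // ltW.
have [le_qm|lt_mq] := leqP q (m ^ d).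
  have m_gt0 : (0 < m)%N.
    by case: m le_qm {le_mN} => //; rewrite exp0n // leqNgt q_gt0.
  apply: le_trans (hA m q a m_gt0 pr_q _ le_qm _ _ x _) _.
  - rewrite powRrM powR_mulrn // powR12_sqrt ?exprn_ge0 //.
    have -> : q%:R = Num.sqrt (q%:R ^+ 2) :> R by rewrite sqrtr_sqr ger0_norm.
    by apply: ler_wsqrtr; rewrite -!natrX ler_nat (leq_trans _ leNq) // leq_exp2r.
  - by lia.
  - by rewrite subrr normr0 divr_ge0.
  apply: ler_pM; rewrite ?mulr_ge0 ?powR_ge0 ?(ltW C_gt0) //.
  apply: ler_pM; rewrite ?powR_ge0 ?(ltW C_gt0) ?lerDl //.
  by apply: ge0_ler_powR; rewrite ?nnegrE ?ler_nat // ltW.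
apply: le_trans (weyl_abs_le_nat _ _ _ _ _) _.
apply: (@le_trans _ _ (q%:R `^ (1 / d%:R))).
  rewrite (natr_powRX R m d) //.
  by apply: ge0_ler_powR; rewrite ?nnegrE ?divr_ge0 ?ler_nat // ltnW.
rewrite ler_peMl ?powR_ge0 //; apply: le_trans N1 _.
by rewrite ler_peMl ?powR_ge0 // lerDr ltW.
Qed.

(** Let [q] be a good prime that witnesses the failure, [m = M %/ q] and [a = j %/ m]. Then
    [a / q = (j - j %% m) / M], so the cell starts at distance [(j %% m) / M] to the right of
    [a / q], with [j %% m < V] and [V / M = 1 / D]. If [a] were 0, then [j %% m = j >= V]. *)
Lemma not_exceptional_rational (R : realType) (D k j : nat) (t : R) :
  (0 < D)%N -> (2 ^ k <= D)%N -> (j < D * D`!)%N -> ~~ exceptional D k j ->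
  j%:R / (D * D`!)%:R <= t <= j.+1%:R / (D * D`!)%:R ->
  exists q a : nat, [/\ prime q, (D <= q ^ 2)%N, (q <= 2 ^ k)%N, (1 <= a < q)%N
    & `|t - a%:R / q%:R| <= 1 / D%:R].
Proof.
move=> D_gt0 le_kD; set V := D`!; set M := (D * V)%N => lt_jM.
rewrite /exceptional -/V -/M negb_or -leqNgt => /andP[le_Vj /allPn[q]].
rewrite mem_good_primes => /and3P[pr_q le_qk le_Dq]; rewrite -ltnNge => lt_jV.
move=> /andP[t_ge t_le].
have q_gt0 := prime_gt0 pr_q.
have V_gt0 : (0 < V)%N by exact: fact_gt0.
have M_gt0 : (0 < M)%N by rewrite muln_gt0 D_gt0.
have dvM : (q %| M)%N.
  by apply/dvdn_mull/dvdn_fact; rewrite q_gt0 (leq_trans le_qk).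
move: lt_jV; set m := (M %/ q)%N => lt_jV.
have eM : (M = m * q)%N by rewrite divnK.
have m_gt0 : (0 < m)%N by move: M_gt0; rewrite eM muln_gt0 => /andP[].
exists q, (j %/ m)%N; split => //.
  apply/andP; split; last by rewrite ltn_divLR // mulnC -eM.
  rewrite divn_gt0 // leqNgt; apply/negP => lt_jm.
  by move: lt_jV; rewrite modn_small // ltnNge le_Vj.
have Mr : 0 < M%:R :> R by rewrite ltr0n.
have Vr : 0 < V%:R :> R by rewrite ltr0n.
have Dr : 0 < D%:R :> R by rewrite ltr0n.
have qr : 0 < q%:R :> R by rewrite ltr0n.
have mr : 0 < m%:R :> R by rewrite ltr0n.
have ea : (j %/ m)%:R / q%:R = (j%:R - (j %% m)%:R) / M%:R :> R.
  rewrite {2}(divn_eq j m) natrD addrK eM !natrM; field.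
  by rewrite !gt_eqF.
have eD : 1 / D%:R = V%:R / M%:R :> R.
  by rewrite /M natrM; field; rewrite !gt_eqF.
have t1 : 0 <= t - (j %/ m)%:R / q%:R.
  rewrite ea mulrBl opprB addrA; set r := _ / M%:R in t_ge *.
  by rewrite addrAC addr_ge0 ?subr_ge0 // divr_ge0.
rewrite ger0_norm // ea eD lerBlDr (le_trans t_le) // -mulrDl ler_pM2r ?invr_gt0 //.
(* What remains is [j %% m < V]: strictness absorbs the step from [j] to the right endpoint [j.+1]
   of the cell. *)
rewrite addrA lerBrDr -!natrD ler_nat; lia.
Qed.

(** The level is the largest [k <= K] at which the cell is exceptional. Failure at [k.+1] supplies a
    prime [q <= 2 ^ k.+1] for the bound; for [k = K] the trivial bound [N] suffices, as
    [N ^ d < 2 ^ K.+1]. The level does not depend on [x], which leaves [x] free for Parseval. *)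
Lemma weyl_abs_level (R : realType) (d N K j : nat) (A : R) (t : R) :
  (1 <= d)%N -> (0 < N)%N -> 1 <= A ->
  (forall (q a : nat) (x t : R), prime q -> (N ^ d <= q ^ 2)%N ->
    (1 <= a < q)%N -> `|t - a%:R / q%:R| <= 1 / (N ^ d)%:R ->
    weyl_abs d N x t <= A * q%:R `^ (1 / d%:R)) ->
  (2 ^ K <= N ^ d < 2 ^ K.+1)%N ->
  (j < N ^ d * (N ^ d)`!)%N ->
  j%:R / (N ^ d * (N ^ d)`!)%:R <= t <= j.+1%:R / (N ^ d * (N ^ d)`!)%:R ->
  exists k : nat, [/\ (k <= K)%N, exceptional (N ^ d) k j &
    forall x, weyl_abs d N x t <= A * (2 ^ k.+1)%:R `^ (1 / d%:R)].
Proof.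
move=> d_gt0 N_gt0 A_ge1 hA /andP[leK ltK] lt_j ht.
have D_gt0 : (0 < N ^ d)%N by rewrite expn_gt0 N_gt0.
have A_ge0 : 0 <= A by exact: le_trans A_ge1.
(* Level 0 always qualifies: there is no prime up to [2 ^ 0], so the condition on all good primes is
   vacuous. *)
have ex0 : exists k, (k <= K)%N && exceptional (N ^ d) k j.
  exists 0%N; apply/orP; right; apply/allP => q.
  by rewrite mem_good_primes => /and3P[/prime_gt1]; rewrite expn0; lia.
have bd k : (k <= K)%N && exceptional (N ^ d) k j -> (k <= K)%N by case/andP.
have [k /andP[le_kK exk] maxk] := ex_maxnP ex0 bd.
exists k; split=> // x; have [lt_kK|] := ltnP k K; last first.
  move=> leKk; apply: le_trans (weyl_abs_le_nat _ _ _ _ _) _.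
  rewrite (natr_powRX R N d) // -[leLHS]mul1r ler_pM ?powR_ge0 //.
  apply: ge0_ler_powR; rewrite ?nnegrE ?divr_ge0 ?ler_nat //.
  by apply: leq_trans (ltnW ltK) _; rewrite leq_exp2l.
have nex : ~~ exceptional (N ^ d) k.+1 j.
  by apply/negP => ex; have := maxk k.+1; rewrite lt_kK ex ltnn => /(_ isT).
have le2 : (2 ^ k.+1 <= N ^ d)%N by apply: leq_trans leK; rewrite leq_exp2l.
have [q [a [pr_q leD leq aq hq]]] :=
  not_exceptional_rational _ _ _ _ _ D_gt0 le2 lt_j nex ht.
apply: le_trans (hA q a x t pr_q leD aq hq) _; apply: ler_wpM2l => //.
by apply: ge0_ler_powR; rewrite ?nnegrE ?divr_ge0 ?ler_nat.
Qed.

(** * Integrals *)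

Lemma integral_is_derive (R : realType) (f G : R -> R) (a b : R) : a < b ->
  (forall x : R, is_derive x (1 : R) G (f x)) -> continuous f ->
  (\int[lebesgue_measure]_(x in `[a, b]) (f x)%:E = (G b - G a)%:E)%E.
Proof.
move=> ab dG cf; rewrite EFinB.
have cG : continuous G.
  by move=> x; apply/differentiable_continuous/derivable1_diffP; case: (dG x).
apply: continuous_FTC2 => //.
- exact: continuous_subspaceT.
- split => [x _||].
  + by case: (dG x).
  + exact/cvg_at_right_filter/cG.
  + exact/cvg_at_left_filter/cG.
by move=> x _; rewrite derive1E; exact: derive_val.
Qed.

Lemma weyl_sumE (R : realType) (d N : nat) (x t : R) :
  weyl_sum d N x t = Complex
    (\sum_(n < N) cos (2 * pi * (t * n.+1%:R ^+ d + x * n.+1%:R)))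
    (\sum_(n < N) sin (2 * pi * (t * n.+1%:R ^+ d + x * n.+1%:R))).
Proof.
rewrite /weyl_sum big_add1 big_mkord /=.
elim: N => [|N IHN]; first by rewrite !big_ord0.
by rewrite !big_ord_recr /= IHN.
Qed.

Lemma weyl_abs_sqE (R : realType) (d N : nat) (x t : R) :
  weyl_abs d N x t ^+ 2 = \sum_(n < N) \sum_(m < N)
    cos (2 * pi * (t * n.+1%:R ^+ d + x * n.+1%:R)
       - 2 * pi * (t * m.+1%:R ^+ d + x * m.+1%:R)).
Proof.
rewrite /weyl_abs weyl_sumE sqr_sqrtr ?addr_ge0 ?sqr_ge0 // !expr2.
rewrite !big_distrlr -big_split; apply: eq_bigr => n _ /=.
by rewrite -big_split; apply: eq_bigr => m _ /=; rewrite cosB.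
Qed.

Lemma sinD2piM (R : realType) (u : R) (n : nat) : sin (u + 2 * pi * n%:R) = sin u.
Proof. by rewrite mulr_natl mulr_natr periodicn //; exact: sinD2pi. Qed.

(** Parseval, by explicit antiderivatives of the cosines in the expanded square: a diagonal term
    contributes 1, and an off-diagonal antiderivative takes equal values at 0 and 1. *)
Lemma integral_weyl_abs_sq (R : realType) (d N : nat) (t : R) :
  (\int[lebesgue_measure]_(x in `[0%R, 1%R]) (weyl_abs d N x t ^+ 2)%:E = N%:R%:E)%E.
Proof.
pose th (x : R) (n : nat) := 2 * pi * (t * n.+1%:R ^+ d + x * n.+1%:R).
pose G (n m : nat) (x : R) : R := if n == m then x else
  sin (th x n - th x m) / (2 * pi * (n.+1%:R - m.+1%:R)).
have dth n x : is_derive x (1:R) (fun x => th x n) (2 * pi * n.+1%:R).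
  rewrite /th; apply: is_derive_eq.
  by rewrite scaler0 !add0r scaler1 /GRing.scale /=; ring.
have dG n m x : is_derive x (1:R) (G n m) (cos (th x n - th x m)).
  rewrite /G; have [->|ne] := eqVneq n m.
    by rewrite subrr cos0; exact: is_derive_id.
  have nz : 2 * pi * (n.+1%:R - m.+1%:R) != 0 :> R.
    rewrite mulf_neq0 //; first by rewrite mulf_neq0 ?pnatr_eq0 // gt_eqF ?pi_gt0.
    by rewrite subr_eq0 eqr_nat eqSS.
  apply: is_derive_eq; rewrite !scaler0 add0r /GRing.scale /=.
  by rewrite [LHS]mulrCA -(mulrBr (2 * pi) n.+1%:R) mulVf ?mulr1.
have cf : continuous (fun x : R => weyl_abs d N x t ^+ 2).
  under eq_fun do rewrite weyl_abs_sqE.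
  move=> x; apply: cvg_big => [|n _]; first exact: add_continuous.
  apply: cvg_big => [|m _]; first exact: add_continuous.
  apply: (@continuous_comp _ _ _ (fun x => th x n - th x m)); last exact: continuous_cos.
  have [+ _] := is_deriveB (dth n x) (dth m x).
  by move/derivable1_diffP/differentiable_continuous.
have dsum (x : R) : is_derive x (1 : R)
    (fun x => \sum_(n < N) \sum_(m < N) G n m x) (weyl_abs d N x t ^+ 2).
  rewrite weyl_abs_sqE.
  have -> : (fun x => \sum_(n < N) \sum_(m < N) G n m x) =
      \sum_(n < N) \sum_(m < N) G n m.
    by apply/funext => y; rewrite fct_sumE; apply: eq_bigr => n _; rewrite fct_sumE.
  apply: is_derive_sum => n; apply: is_derive_sum => m; exact: dG.
have -> := @integral_is_derive R _ _ 0 1 ltr01 dsum cf.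
congr EFin; rewrite -sumrB.
rewrite (eq_bigr (fun=> 1)) ?sumr_const ?card_ord // => n _.
rewrite -sumrB (bigD1 n) //= big1 => [|m ne].
  by rewrite /G eqxx subr0 addr0.
have /negPf nm : n != m :> nat by rewrite eq_sym.
rewrite /G nm -mulrBl.
suff -> : sin (th 1 n - th 1 m) = sin (th 0 n - th 0 m) by rewrite subrr mul0r.
(* The two arguments differ by [2 * pi * (n - m)], possibly negative; shifting each side by a
   natural multiple of the period avoids signed integers. *)
rewrite -(sinD2piM _ (th 1 n - th 1 m) m.+1) -(sinD2piM _ (th 0 n - th 0 m) n.+1).
by congr sin; rewrite /th; ring.
Qed.

Lemma measurable_weyl_abs (R : realType) (d N : nat) :
  measurable_fun setT (fun z : R * R => weyl_abs d N z.1 z.2).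
Proof.
have mth n : measurable_fun setT
    (fun z : R * R => 2 * pi * (z.2 * n.+1%:R ^+ d + z.1 * n.+1%:R)).
  apply: measurable_funM; first exact: measurable_cst.
  apply: measurable_funD; apply: measurable_funM; try exact: measurable_cst.
    exact: measurable_snd.
  exact: measurable_fst.
under eq_fun do rewrite /weyl_abs weyl_sumE /=.
apply: (measurableT_comp (f := @Num.sqrt R)).
  exact: continuous_measurable_fun (@sqrt_continuous R).
apply: measurable_funD; apply: measurable_funX; apply: measurable_sum => n.
  apply: (measurableT_comp (f := @cos R)) (mth n).
  exact: continuous_measurable_fun (@continuous_cos R).
apply: (measurableT_comp (f := @sin R)) (mth n).
exact: continuous_measurable_fun (@continuous_sin R).
Qed.


(** Tonelli with [t] outermost, so that Parseval can be applied to the inner integral over [x]. *)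
Lemma integral_square (R : realType) (f : R * R -> \bar R) :
  measurable_fun setT f -> (forall z, 0 <= f z)%E ->
  (\int[lebesgue_measure \x lebesgue_measure]_(z in `[0%R, 1%R] `*` `[0%R, 1%R]) f z
   = \int[lebesgue_measure]_(t in `[0%R, 1%R])
       \int[lebesgue_measure]_(x in `[0%R, 1%R]) f (x, t))%E.
Proof.
move=> mf f0.
have mI : measurable (`[0%R, 1%R] : set R) by exact: measurable_itv.
rewrite integral_mkcond fubini_tonelli2 //; last 2 first.
- apply: (measurable_restrictT _ (measurableX mI mI)).1.
  exact: measurable_funTS.
- by move=> z; rewrite patchE; case: ifP.
rewrite [RHS]integral_mkcond; apply: eq_integral => t _.
rewrite patchE /fubini_G; case: ifPn => [|] ht.
  rewrite [RHS]integral_mkcond; apply: eq_integral => x _.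
  rewrite !patchE; congr (if _ then _ else _).
  by apply/idP/idP; rewrite !inE /=; [case|move=> ?; split=> //; rewrite inE in ht].
rewrite -[RHS](integral0 lebesgue_measure setT); apply: eq_integral => x _.
rewrite patchE ifN //; apply: contra ht; rewrite !inE; by case.
Qed.

Lemma grid_cell (R : realType) (M : nat) (t : R) : (0 < M)%N -> 0 <= t <= 1 ->
  exists2 j : nat, (j < M)%N & j%:R / M%:R <= t <= j.+1%:R / M%:R.
Proof.
move=> M_gt0 /andP[t_ge0 t_le1].
have Mr : 0 < M%:R :> R by rewrite ltr0n.
(* At [t = 1] the truncation of [t * M] would be [M], out of range; this point goes to the last
   closed cell. *)
have [t1|] := eqVneq t 1.
  exists M.-1; first by rewrite prednK.
  rewrite prednK // divff ?gt_eqF // t1 lexx andbT.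
  by rewrite ler_pdivrMr // mul1r ler_nat leq_pred.
move=> t1; have {}t1 : t < 1 by rewrite lt_neqAle t1.
exists (Num.truncn (t * M%:R)).
  rewrite -(ltr_nat R); apply: (@le_lt_trans _ _ (t * M%:R)).
    by rewrite truncn_le // mulr_ge0.
  by rewrite -[ltRHS]mul1r ltr_pM2r.
rewrite ler_pdivrMr // truncn_le ?mulr_ge0 //= ler_pdivlMr //.
by rewrite ltW // truncnS_gt.
Qed.

(** [g] is dominated by the sum of [h j] times the indicator of the closed cell [I j]. Neighbouring
    cells share an endpoint, which is harmless for an upper bound since [h] is nonnegative. *)
Lemma integral_step_le (R : realType) (M : nat) (g : R -> \bar R) (h : nat -> R) :
  (0 < M)%N -> measurable_fun (`[0%R, 1%R] : set R) g ->
  (forall t, 0 <= g t)%E -> (forall j, 0 <= h j) ->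
  (forall (j : nat) (t : R), (j < M)%N -> j%:R / M%:R <= t <= j.+1%:R / M%:R ->
    (g t <= (h j)%:E)%E) ->
  (\int[lebesgue_measure]_(t in `[0%R, 1%R]) g t
     <= ((\sum_(j < M) h j) / M%:R)%:E)%E.
Proof.
move=> M_gt0 mg g_ge0 h_ge0 gh.
have Mr : 0 < M%:R :> R by rewrite ltr0n.
pose I (j : nat) : set R := [set` `[j%:R / M%:R, j.+1%:R / M%:R]].
have mI j : measurable (I j) by exact: measurable_itv.
have m01 : measurable (`[0%R, 1%R] : set R) by exact: measurable_itv.
have mindic (j : nat) : measurable_fun (`[0%R, 1%R] : set R)
    (fun t => (\1_(I j) t : R)%:E).
  by apply/measurable_EFinP; exact: measurable_indic.
have mterm (j : nat) : measurable_fun (`[0%R, 1%R] : set R)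
    (fun t => (h j)%:E * (\1_(I j) t)%:E)%E.
  exact: measurable_funeM.
apply: (@le_trans _ _ (\int[lebesgue_measure]_(t in `[0%R, 1%R])
   (\sum_(j < M) ((h j)%:E * (\1_(I j) t)%:E)))%E).
  apply: ge0_le_integral => //.
    by apply: emeasurable_sum => j; exact: mterm.
  move=> t /=; rewrite in_itv /= => /(grid_cell _ _ _ M_gt0)[j lt_jM tj].
  apply: le_trans (gh j t lt_jM tj) _.
  rewrite (bigD1 (Ordinal lt_jM)) //= indicE mem_set ?mule1; last first.
    by rewrite /I /= in_itv.
  rewrite leeDl // sume_ge0 // => i _.
  by rewrite mule_ge0 ?lee_fin.
rewrite ge0_integral_sum //; last 2 first.
- by move=> j; exact: mterm.
- by move=> j t _; rewrite mule_ge0 ?lee_fin.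
rewrite mulr_suml -sumEFin; apply: lee_sum => j _.
rewrite ge0_integralZl_EFin ?lee_fin //; last first.
  exact: mindic.
rewrite EFinM lee_wpmul2l ?lee_fin // integral_indic //; last exact: mI.
have -> : (M%:R^-1)%:E = lebesgue_measure (I j).
  rewrite lebesgue_measure_itv /= lte_fin ltr_pM2r ?invr_gt0 // ltr_nat ltnSn.
  by rewrite -EFinB -mulrBl -natrB // subSnn mul1r.
apply: le_measure; rewrite ?inE //; last exact: mI.
by apply: measurableI; [exact: mI|exact: m01].
Qed.

(** Restricting [f] to the strip over [[0, 1]] turns the slice integral into one over the whole
    line, to which Tonelli's measurability statement applies. *)
Lemma measurable_integral_slice (R : realType) (f : R * R -> \bar R) :
  measurable_fun setT f -> (forall z, 0 <= f z)%E ->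
  measurable_fun (setT : set R)
    (fun t => \int[lebesgue_measure]_(x in `[0%R, 1%R]) f (x, t))%E.
Proof.
move=> mf f0.
have mI : measurable (`[0%R, 1%R] : set R) by exact: measurable_itv.
pose g := f \_ (`[0%R, 1%R] `*` setT).
have mg : measurable_fun setT g.
  apply: (measurable_restrictT _ (measurableX mI measurableT)).1.
  exact: measurable_funTS.
have g0 z : (0 <= g z)%E by rewrite /g patchE; case: ifP.
have := measurable_fun_fubini_tonelli_G (m1 := @lebesgue_measure R) g mg g0.
congr measurable_fun; apply/funext => t; rewrite /fubini_G [RHS]integral_mkcond.
apply: eq_integral => x _; rewrite /g !patchE; congr (if _ then _ else _).
by apply/idP/idP; rewrite !inE /=; [case|].
Qed.

Lemma weyl_abs_ge0 (R : realType) (d N : nat) (x t : R) : 0 <= weyl_abs d N x t.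
Proof. exact: normc_ge0. Qed.

(** All but two of the [2 * p] factors are bounded by [B]; Parseval evaluates the integral of the
    remaining square. *)
Lemma integral_weyl_abs_powR_le (R : realType) (d N : nat) (p t B : R) : 1 <= p ->
  (forall x, weyl_abs d N x t <= B) ->
  (\int[lebesgue_measure]_(x in `[0%R, 1%R]) (weyl_abs d N x t `^ (2 * p))%:E
    <= (B `^ (2 * p - 2) * N%:R)%:E)%E.
Proof.
move=> p_ge1 hB; have B_ge0 : 0 <= B := le_trans (weyl_abs_ge0 _ _ _ _ _) (hB 0).
have mw : measurable_fun setT (fun x : R => weyl_abs d N x t).
  exact: (measurableT_comp (measurable_weyl_abs R d N) (pair2_measurable t)).
have mwp : measurable_fun setT (fun x : R => weyl_abs d N x t `^ (2 * p)).
  exact: (measurableT_comp (measurable_powR (2 * p)) mw).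
have m01 : measurable (`[0%R, 1%R] : set R) by exact: measurable_itv.
have mw2 : measurable_fun (`[0%R, 1%R] : set R)
    (fun x : R => (weyl_abs d N x t ^+ 2)%:E).
  by apply/measurable_EFinP; apply: measurable_funTS; exact: measurable_funX.
apply: (@le_trans _ _ (\int[lebesgue_measure]_(x in `[0%R, 1%R])
  ((B `^ (2 * p - 2))%:E * (weyl_abs d N x t ^+ 2)%:E))%E).
  apply: ge0_le_integral => //.
  - by move=> x _; rewrite lee_fin powR_ge0.
  - apply/measurable_EFinP; apply: measurable_funTS.
    exact: mwp.
  - by apply: measurable_funeM; exact: mw2.
  move=> x _; rewrite -EFinM lee_fin.
  have w0 := weyl_abs_ge0 _ d N x t.
  have -> : 2 * p = (2 * p - 2) + 2%:R by rewrite subrK.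
  (* The base may be 0, so splitting the power requires the total exponent [2 * p] to be nonzero. *)
  rewrite powRD; last by rewrite gt_eqF //; lra.
  rewrite addrK powR_mulrn // ler_wpM2r ?sqr_ge0 //.
  by apply: ge0_ler_powR; rewrite ?nnegrE //; lra.
rewrite ge0_integralZl_EFin ?powR_ge0 //; last by move=> x _; rewrite lee_fin sqr_ge0.
by rewrite integral_weyl_abs_sq -EFinM.
Qed.

Lemma weyl_moment_le_levels (R : realType) (d N K : nat) (A p : R) :
  (1 <= d)%N -> (0 < N)%N -> 1 <= p -> 1 <= A ->
  (forall (q a : nat) (x t : R), prime q -> (N ^ d <= q ^ 2)%N ->
    (1 <= a < q)%N -> `|t - a%:R / q%:R| <= 1 / (N ^ d)%:R ->
    weyl_abs d N x t <= A * q%:R `^ (1 / d%:R)) ->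
  (2 ^ K <= N ^ d < 2 ^ K.+1)%N ->
  (weyl_moment d N p <= (\sum_(k < K.+1)
     (A * (2 ^ k.+1)%:R `^ (1 / d%:R)) `^ (2 * p - 2) * N%:R *
     ((97 * k.+1 ^ 2 * N ^ d)%:R / (4 ^ k)%:R))%:E)%E.
Proof.
move=> d_gt0 N_gt0 p_ge1 A_ge1 hA hK; set D := (N ^ d)%N.
pose L k := (A * (2 ^ k.+1)%:R `^ (1 / d%:R)) `^ (2 * p - 2) * N%:R.
have L_ge0 k : 0 <= L k by rewrite mulr_ge0 ?powR_ge0.
have D_gt0 : (0 < D)%N by rewrite expn_gt0 N_gt0.
have M_gt0 : (0 < D * D`!)%N by rewrite muln_gt0 D_gt0 fact_gt0.
set M := (D * D`!)%N in M_gt0 *.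
pose f (z : R * R) := (weyl_abs d N z.1 z.2 `^ (2 * p))%:E.
have mf : measurable_fun setT f.
  apply/measurable_EFinP.
  exact: (measurableT_comp (measurable_powR (2 * p)) (measurable_weyl_abs R d N)).
have f_ge0 z : (0 <= f z)%E by rewrite lee_fin powR_ge0.
rewrite /weyl_moment (integral_square R f mf f_ge0).
(* Summing over all exceptional levels of a cell dominates the one level that bounds the Weyl sum
   there, and exchanging the sums then yields the number of exceptional cells at each level. *)
pose h j := \sum_(k < K.+1) (exceptional D k j)%:R * L k.
apply: le_trans (integral_step_le R M _ h M_gt0 _ _ _ _) _.
- exact: measurable_funTS (measurable_integral_slice R f mf f_ge0).
- by move=> t; apply: integral_ge0 => x _.
- by move=> j; apply: sumr_ge0 => k _; rewrite mulr_ge0.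
- move=> j t lt_jM ht.
  have [k [le_kK exk hk]] :=
    weyl_abs_level R d N K j A t d_gt0 N_gt0 A_ge1 hA hK lt_jM ht.
  apply: le_trans (integral_weyl_abs_powR_le R d N p t _ p_ge1 hk) _.
  rewrite lee_fin -/(L k) /h (bigD1 (Ordinal (le_kK : (k < K.+1)%N))) //= exk mul1r.
  by rewrite lerDl sumr_ge0 // => i _; rewrite mulr_ge0.
rewrite lee_fin /h exchange_big /= mulr_suml; apply: ler_sum => k _.
rewrite -mulr_suml -natr_sum -/(L k) mulrAC [leLHS]mulrC ler_wpM2l //.
have Mr : 0 < M%:R :> R by rewrite ltr0n.
have r4 : 0 < (4 ^ k)%:R :> R by rewrite ltr0n expn_gt0.
rewrite ler_pdivrMr // mulrAC ler_pdivlMr // -!natrM ler_nat mulnC.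
apply: count_exceptional => //.
case/andP: hK => hK _; apply: leq_trans hK.
by rewrite leq_exp2l // -ltnS.
Qed.

(** * Summation over the levels *)

(** The number of levels is logarithmic in [N]: [1 + K * del <= expR (K * del)], and [del] is chosen
    so that the right side equals [(2 ^ K)]^ (eps / d)[, which is at most]N [^ eps]. *)
Lemma exponent_le_powR (R : realType) (d : nat) (eps : R) : (0 < d)%N -> 0 < eps ->
  exists2 c : R, 0 < c & forall N K : nat, (2 ^ K <= N ^ d)%N ->
    K.+1%:R <= c * N%:R `^ eps.
Proof.
move=> d_gt0 eps_gt0; have dr : 0 < d%:R :> R by rewrite ltr0n.
have ln2 : 0 < ln 2 :> R by rewrite ln_gt0 // ltr1n.
pose del := eps / d%:R * ln (2 : R).
have del_gt0 : 0 < del by rewrite mulr_gt0 ?divr_gt0.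
exists (1 + del^-1) => [|N K leK]; first by rewrite addr_gt0 ?invr_gt0.
have le1 : 1 + K%:R * del <= N%:R `^ eps.
  apply: le_trans (expR_ge1Dx _) _.
  have -> : expR (K%:R * del) = (2 ^ K)%:R `^ (eps / d%:R) :> R.
    rewrite /powR pnatr_eq0 expn_eq0 /= natrX lnXn // /del; congr expR.
    by rewrite -mulr_natl; ring.
  have -> : N%:R `^ eps = (N ^ d)%:R `^ (eps / d%:R) :> R.
    rewrite natrX -powR_mulrn // -powRrM; congr powR.
    by rewrite mulrC divfK // gt_eqF.
  by apply: ge0_ler_powR; rewrite ?nnegrE ?divr_ge0 ?ler_nat // ltW.
apply: (@le_trans _ _ ((1 + del^-1) * (1 + K%:R * del))).
  have -> : (1 + del^-1) * (1 + K%:R * del) = K%:R + 1 + (del^-1 + K%:R * del).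
    by field; rewrite gt_eqF.
  rewrite natr1 lerDl.
  have : 0 <= K%:R * del by rewrite mulr_ge0 // ltW.
  have : 0 < del^-1 by rewrite invr_gt0.
  by move=> /ltW h1 h2; rewrite addr_ge0.
by rewrite ler_wpM2l // addr_ge0 // invr_ge0 ltW.
Qed.

(* Each level contributes at most what the top level [2 ^ k = N ^ d] does, because
   [(2 * p - 2) / d >= 2]. *)
Lemma level_le (R : realType) (d N K k : nat) (A p : R) :
  (0 < d)%N -> (0 < N)%N -> d%:R + 1 <= p -> 0 <= A ->
  (2 ^ K <= N ^ d)%N -> (k <= K)%N ->
  (A * (2 ^ k.+1)%:R `^ (1 / d%:R)) `^ (2 * p - 2) * N%:R *
     ((97 * k.+1 ^ 2 * N ^ d)%:R / (4 ^ k)%:R)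
  <= 97 * 2 `^ ((2 * p - 2) / d%:R) * A `^ (2 * p - 2) * K.+1%:R ^+ 2
     * N%:R `^ (2 * p - d%:R - 1).
Proof.
move=> d_gt0 N_gt0 hp A_ge0 leK le_kK.
have dr : 0 < d%:R :> R by rewrite ltr0n.
have Nr : 0 < N%:R :> R by rewrite ltr0n.
set s := (2 * p - 2) / d%:R.
have s_ge2 : 2 <= s by rewrite ler_pdivlMr //; lra.
have N0 : N%:R != 0 :> R by rewrite gt_eqF.
have t0 : (2 ^ k)%:R != 0 :> R by rewrite pnatr_eq0 expn_eq0.
(* Splitting off [4 ^ k] cancels the denominator coming from the count of cells, and leaves the
   power [s - 2 >= 0], which is monotone in the level. *)
have e1 : (A * (2 ^ k.+1)%:R `^ (1 / d%:R)) `^ (2 * p - 2)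
    = A `^ (2 * p - 2) * (2 `^ s * ((2 ^ k)%:R `^ (s - 2) * (4 ^ k)%:R)).
  rewrite powRM ?powR_ge0 // -powRrM; congr (_ * _).
  have -> : 1 / d%:R * (2 * p - 2) = s by rewrite /s; ring.
  rewrite expnS natrM powRM //; congr (_ * _).
  have -> : (4 ^ k)%:R = (2 ^ k)%:R `^ 2%:R :> R.
    by rewrite powR_mulrn // -natrX -expnM mulnC expnM.
  by rewrite -powRD ?subrK // t0 implybT.
(* Since [d * s = 2 * p - 2], the exponents on the right add up:
   [d * (s - 2) + 1 + d = 2 * p - d - 1]. *)
have e2 : N%:R `^ (2 * p - d%:R - 1) = (N ^ d)%:R `^ (s - 2) * (N%:R * (N ^ d)%:R) :> R.
  rewrite !natrX -!powR_mulrn // -powRrM -[X in _ * (X * _)](powRr1 (ltW Nr)).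
  rewrite -!powRD ?N0 ?implybT //; congr powR.
  rewrite /s mulrBr mulrCA divff ?gt_eqF //.
  ring.
have r4 : (4 ^ k)%:R != 0 :> R by rewrite pnatr_eq0 expn_eq0.
rewrite e1 e2 !natrM.
set P := (2 ^ k)%:R `^ (s - 2); set Q := (N ^ d)%:R `^ (s - 2).
have lePQ : P <= Q.
  apply: ge0_ler_powR; rewrite ?nnegrE ?subr_ge0 // ler_nat.
  by apply: leq_trans leK; rewrite leq_exp2l.
have leK2 : k.+1%:R * k.+1%:R <= K.+1%:R ^+ 2 :> R.
  by rewrite -expr2 lerXn2r ?nnegrE ?ler_nat.
have -> : A `^ (2 * p - 2) * (2 `^ s * (P * (4 ^ k)%:R)) * N%:R *
    (97%:R * (k.+1%:R * k.+1%:R) * (N ^ d)%:R / (4 ^ k)%:R)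
  = (97 * 2 `^ s * A `^ (2 * p - 2)) * ((k.+1%:R * k.+1%:R) * P) * (N%:R * (N ^ d)%:R).
  by field.
set U := 97 * _ * _; set W := N%:R * _.
have -> : U * K.+1%:R ^+ 2 * (Q * W) = U * (K.+1%:R ^+ 2 * Q) * W by ring.
rewrite ler_wpM2r ?mulr_ge0 // ler_wpM2l ?mulr_ge0 ?powR_ge0 //.
by rewrite ler_pM ?powR_ge0.
Qed.

Theorem theorem1p3 (R : realType) (d : nat) (hd : (1 <= d)%N)
    (hA : hypothesisA R d) :
  forall p : R, d%:R + 1 <= p ->
  forall eps : R, 0 < eps ->
  exists2 C : R, 0 < C &
    forall N : nat, (0 < N)%N ->
    (weyl_moment d N p <= (C * N%:R `^ (2 * p - d%:R - 1 + eps))%:E)%E.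
Proof.
move=> p hp eps eps_gt0.
have d1 : 1 <= d%:R :> R by rewrite ler1n.
have pp : 0 < 2 * p + 1 by lra.
pose e := eps / (2 * p + 1); have e_gt0 : 0 < e by rewrite divr_gt0.
have [C C_gt0 hC] := hA e e_gt0.
have [c c_gt0 hc] := exponent_le_powR R d e hd e_gt0.
pose c1 := (1 + 4 * pi) * (C + 1) : R.
have pi0 := pi_ge0 R.
have c1_ge1 : 1 <= c1 by rewrite /c1 -[leLHS]mulr1 ler_pM //; lra.
have c1_gt0 : 0 < c1 by apply: lt_le_trans c1_ge1.
exists (97 * 2 `^ ((2 * p - 2) / d%:R) * c1 `^ (2 * p - 2) * c ^+ 3).
  by rewrite !mulr_gt0 ?powR_gt0 ?exprn_gt0.
move=> N N_gt0; have Nr : 0 < N%:R :> R by rewrite ltr0n.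
set n := N%:R `^ e; have n_ge1 : 1 <= n.
  by rewrite -[leLHS](powRr0 N%:R); apply: ler_powR; rewrite ?ler1n // ltW.
pose A := c1 * n; have A_ge1 : 1 <= A by rewrite /A -[leLHS]mulr1 ler_pM.
have D_gt0 : (0 < N ^ d)%N by rewrite expn_gt0 N_gt0.
pose K := trunc_log 2 (N ^ d).
have hK : (2 ^ K <= N ^ d < 2 ^ K.+1)%N by exact: trunc_log_bounds.
have p_ge1 : 1 <= p by lra.
have hbound : forall (q a : nat) (x t : R), prime q -> (N ^ d <= q ^ 2)%N ->
    (1 <= a < q)%N -> `|t - a%:R / q%:R| <= 1 / (N ^ d)%:R ->
    weyl_abs d N x t <= A * q%:R `^ (1 / d%:R).
  move=> q a x t pr_q leq aq ht; rewrite /A /c1 -!mulrA [(1 + _) * _]mulrC.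
  have := weyl_abs_major R d e C N q a x t hd e_gt0 C_gt0 hC N_gt0 pr_q leq aq ht.
  by rewrite -/n !mulrA; congr (_ <= _); ring.
apply: le_trans (weyl_moment_le_levels R d N K A p hd N_gt0 p_ge1 A_ge1 hbound hK) _.
case/andP: hK => leK _; rewrite lee_fin.
set B := 97 * 2 `^ ((2 * p - 2) / d%:R) * A `^ (2 * p - 2) * K.+1%:R ^+ 2
     * N%:R `^ (2 * p - d%:R - 1).
apply: (@le_trans _ _ (\sum_(k < K.+1) B)).
  apply: ler_sum => k _.
  by apply: level_le; rewrite // ?(le_trans ler01) // -ltnS.
rewrite sumr_const card_ord -[leLHS]mulr_natl.
have eN : N%:R `^ (2 * p - d%:R - 1 + eps)
    = n `^ (2 * p - 2) * n ^+ 3 * N%:R `^ (2 * p - d%:R - 1).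
  have N0 : N%:R != 0 :> R by rewrite gt_eqF.
  rewrite -powR_mulrn ?powR_ge0 // /n -!powRrM -!powRD ?N0 ?implybT //.
  congr powR; have -> : eps = e * (2 * p + 1) by rewrite divfK // gt_eqF.
  ring.
have eA : A `^ (2 * p - 2) = c1 `^ (2 * p - 2) * n `^ (2 * p - 2).
  by rewrite powRM ?powR_ge0 // ltW.
have leK3 : K.+1%:R ^+ 3 <= c ^+ 3 * n ^+ 3.
  by rewrite -exprMn lerXn2r ?nnegrE ?mulr_ge0 ?powR_ge0 ?(ltW c_gt0) // hc.
rewrite eN /B eA.
set x1 := 2 `^ _; set x2 := c1 `^ _; set x3 := n `^ _; set x4 := N%:R `^ _.
have -> : K.+1%:R * (97 * x1 * (x2 * x3) * K.+1%:R ^+ 2 * x4)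
  = (97 * x1 * x2 * x3 * x4) * K.+1%:R ^+ 3 by ring.
have -> : 97 * x1 * x2 * c ^+ 3 * (x3 * n ^+ 3 * x4)
  = (97 * x1 * x2 * x3 * x4) * (c ^+ 3 * n ^+ 3) by ring.
by rewrite ler_wpM2l // !mulr_ge0 ?powR_ge0.
Qed.
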